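(* Let $p$ be a prime, let $H$ and $K$ be finite $p$-groups, let $A\leqslant H$ and $B\leqslant K$ be subgroups and let $\varphi:A\to B$ be an isomorphism. Let $G=\bigl(H*K;\ A=B,\ \varphi\bigr)$ be the free product of $H$ and $K$ with subgroups $A$ and $B$ amalgamated via $\varphi$. Then $G$ is a conjugacy $p$-separable group if and only if $G$ is residually a finite $p$-group.
   Context: $\bigl(H*K;\ A=B,\ \varphi\bigr)$ denotes the generalized free product (amalgamated free product) obtained from the free product $H*K$ by adding the relations $a=a\varphi$ for all $a\in A$. A group $G$ is conjugacy $p$-separable if whenever elements $a,b\in G$ are not conjugate in $G$, there is a homomorphism $\psi$ of $G$ onto a finite $p$-group $X$ such that $a\psi$ and $b\psi$ are not conjugate in $X$. A group is residually a finite $p$-group if for every nontrivial element there is a homomorphism onto a finite $p$-group not sending it to $1$. *)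

(* Defs.v *)
From HB Require Import structures.
From mathcomp Require Import all_boot all_fingroup all_solvable.
Set Implicit Arguments. Unset Strict Implicit. Unset Printing Implicit Defensive.

Record AbsGroup := MkGroup {
  carrier :> Type;
  gmul : carrier -> carrier -> carrier;
  ginv : carrier -> carrier;
  gone : carrier;
  gmulA : forall x y z, gmul x (gmul y z) = gmul (gmul x y) z;
  gmul1 : forall x, gmul gone x = x;
  gmulV : forall x, gmul (ginv x) x = gone }.

Definition is_hom (G X : AbsGroup) (f : G -> X) :=
  forall x y, f (gmul x y) = gmul (f x) (f y).

Definition is_fhom (G : AbsGroup) (gT : finGroupType) (f : G -> gT) :=
  forall x y, f (gmul x y) = (f x * f y)%g.

Definition hom_on (hT : finGroupType) (H : {set hT}) (X : AbsGroup) (f : hT -> X) :=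
  forall x y, x \in H -> y \in H -> f (x * y)%g = gmul (f x) (f y).

(* G, together with iH, iK, is the generalized free product
   (H * K; A = B, phi): the pushout of H <- A -> K (A -> K via phi)
   in the category of groups. *)
Definition is_amalgam (hT kT : finGroupType) (H A : {group hT}) (K : {group kT})
    (phi : hT -> kT) (G : AbsGroup) (iH : hT -> G) (iK : kT -> G) :=
  [/\ hom_on H iH, hom_on K iK,
      (forall a, a \in A -> iH a = iK (phi a)) &
      forall (X : AbsGroup) (f : hT -> X) (g : kT -> X),
        hom_on H f -> hom_on K g -> (forall a, a \in A -> f a = g (phi a)) ->
        (exists h : G -> X, [/\ is_hom h,
            forall x, x \in H -> h (iH x) = f x &
            forall y, y \in K -> h (iK y) = g y]) /\
        (forall h1 h2 : G -> X, is_hom h1 -> is_hom h2 ->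
            (forall x, x \in H -> h1 (iH x) = f x) ->
            (forall y, y \in K -> h1 (iK y) = g y) ->
            (forall x, x \in H -> h2 (iH x) = f x) ->
            (forall y, y \in K -> h2 (iK y) = g y) ->
            forall z, h1 z = h2 z)].

Definition conjugate_in (G : AbsGroup) (a b : G) :=
  exists c : G, gmul (ginv c) (gmul a c) = b.

Definition onto_p_group (p : nat) (G : AbsGroup) (gT : finGroupType) (psi : G -> gT) :=
  [/\ is_fhom psi, (forall y : gT, exists x, psi x = y) & (p.-group [set: gT])%g].

Definition conj_p_separable (p : nat) (G : AbsGroup) :=
  forall a b : G, ~ conjugate_in a b ->
    exists (gT : finGroupType) (psi : G -> gT),
      onto_p_group p psi /\ ~ (exists x : gT, (psi a ^ x)%g = psi b).

Definition residually_p (p : nat) (G : AbsGroup) :=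
  forall g : G, g <> gone G ->
    exists (gT : finGroupType) (psi : G -> gT),
      onto_p_group p psi /\ psi g <> 1%g.

(* Main.v *)
(** Let psi be a homomorphism of G onto a finite p-group P. The cosets of psi(A) in P are the
    edges of a finite quotient of the Bass-Serre tree of G, and keeping psi on H while
    conjugating it on K by the edge e = psi(A) in the semidirect product of the chains
    C_1 = R[P / psi(A)] (R = Z/p^k) with P gives a homomorphism to a larger p-group. Its
    C_1-component is a cocycle c : G -> C_1 sending g to the chain of the path from the base
    vertex to its translate by g. If a and b are conjugate in every finite p-quotient,
    then a g = g b holds after this homomorphism for some g, which constrains the chains:
    - since c(1) = 0, nontrivial reduced words are nontrivial in G (normal forms);
    - if a and b fix vertices x and y, the chain of a path from x to g y is invariant under
      psi(a); as the edges it moves fall into orbits of size divisible by p, x and g y are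
      linked by fixed edges, which lift to the tree when psi is injective on H and K;
    - if a and b are hyperbolic and a has the longer period, pair c(a) and g c(b) with the
      function equal to 1 or -1, according to orientation, on the orbits of the edges of the
      axis of a under the centralizer of psi(a). The first pairing is the length of a, hence
      so is the second, so the translated axis of b runs along the axis of a modulo that
      centralizer. Once psi detects the finitely many relevant commutators with a, elements
      centralizing psi(a) centralize a, and the two axes agree in the tree.
    An elliptic and a hyperbolic element are distinguished by their orders. *)
Require Import Defs.
From HB Require Import structures.
From mathcomp Require Import all_boot all_fingroup all_algebra all_solvable.
From mathcomp Require Import boolp ring.
Set Implicit Arguments. Unset Strict Implicit. Unset Printing Implicit Defensive.
Import GRing.Theory.
Local Open Scope group_scope.

(** On the level set of a nonzero value, [s] has no fixed point, so its orbits there have size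
    divisible by [p] and the value is added a multiple of [p] times. *)
Lemma sum_perm_invariant (p : nat) (X : finType) (s : {perm X}) (R : finNzRingType)
    (f : X -> R) :
  p \in [pchar R]%R -> p.-elt s -> (forall x, f (s x) = f x) ->
  (forall x, s x = x -> f x = 0%R) -> (\sum_x f x = 0)%R.
Proof.
move=> charp ps fs f0.
rewrite (partition_big f predT) //= big1 // => v _.
have [-> | vN0] := eqVneq v 0%R; first by rewrite big1 // => x /eqP.
rewrite (eq_bigr (fun=> v)) => [|x /eqP //]; rewrite sumr_const.
pose S := [set x | f x == v].
have actS : [acts <[s]>, on S | 'P].
  apply/actsP => _ /cycleP[k ->] x; rewrite !inE /= apermE.
  by elim: k x => [|k IHk] x; rewrite ?perm1 // expgS permM IHk fs.
have := pgroup_fix_mod ps actS.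
have -> : 'Fix_(S | 'P)(<[s]>) = set0.
  apply/setP=> x; rewrite !inE; apply/negP => /andP[/eqP fxv].
  move/subsetP/(_ s (cycle_id s)); rewrite inE /= apermE => /eqP/f0 fx0.
  by move/eqP: vN0; rewrite -fxv fx0.
rewrite cards0 mod0n cardsE => /eqP /dvdnP[q ->].
by rewrite mulnC mulrnA -(mulr_natr v p) (pcharf0 charp) mulr0 mul0rn.
Qed.

(** * Chains of edges and the twisted extension *)

Section Chains.

Variables (R : finNzRingType) (P : finGroupType).

(** Every subset of [P] may carry a coefficient, so translation acts on one fixed type; the edges
    used are cosets of the image of [A]. *)
Definition chain := {ffun {set P} -> R}.

Implicit Types (x y : P) (c d : chain) (E : {set P}).

Definition ctrans x c : chain := [ffun E => c (x^-1 *: E)].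

Lemma ctransM x y c : ctrans (x * y) c = ctrans x (ctrans y c).
Proof. by apply/ffunP=> E; rewrite !ffunE invMg lcosetM. Qed.

Lemma ctrans1 c : ctrans 1 c = c.
Proof. by apply/ffunP=> E; rewrite ffunE invg1 lcoset1. Qed.

Lemma ctransD x c d : ctrans x (c + d)%R = (ctrans x c + ctrans x d)%R.
Proof. by apply/ffunP=> E; rewrite !ffunE. Qed.

Lemma ctransN x c : ctrans x (- c)%R = (- ctrans x c)%R.
Proof. by apply/ffunP=> E; rewrite !ffunE. Qed.

Definition twist := (chain * P)%type.
HB.instance Definition _ := Finite.on twist.

Implicit Types u v w : twist.
Let tmul u v : twist := ((u.1 + ctrans u.2 v.1)%R, u.2 * v.2).
Let tone : twist := (0%R, 1).
Let tinv u : twist := ((- ctrans u.2^-1%g u.1)%R, u.2^-1).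

Fact tmulA : associative tmul.
Proof.
by move=> u v w; rewrite /tmul /= ctransD ctransM addrA mulgA.
Qed.
Fact tmul1 : left_id tone tmul.
Proof. by case=> c x; rewrite /tmul /= ctrans1 add0r mul1g. Qed.
Fact tmulV : left_inverse tone tinv tmul.
Proof. by move=> u; rewrite /tmul /= mulVg addNr. Qed.
HB.instance Definition _ := Finite_isGroup.Build twist tmulA tmul1 tmulV.

Lemma twistE u v : u * v = ((u.1 + ctrans u.2 v.1)%R, u.2 * v.2) :> twist.
Proof. by []. Qed.

Lemma twist_pgroup (p : nat) :
  p.-nat #|R| -> p.-group [set: P] -> p.-group [set: twist].
Proof.
rewrite /pgroup !cardsT => pR pP.
by rewrite card_prod pnatM card_ffun pnatX pR pP.
Qed.

Definition pairing (t : {set P} -> R) c : R := (\sum_E t E * c E)%R.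

Lemma pairingD t c d : pairing t (c + d)%R = (pairing t c + pairing t d)%R.
Proof. by rewrite /pairing -big_split; apply: eq_bigr => E _; rewrite ffunE mulrDr. Qed.

Lemma pairingN t c : pairing t (- c)%R = (- pairing t c)%R.
Proof. by rewrite /pairing -sumrN; apply: eq_bigr => E _; rewrite ffunE mulrN. Qed.

Lemma pairing0 t : pairing t 0%R = 0%R.
Proof. by rewrite /pairing big1 // => E _; rewrite ffunE mulr0. Qed.

Lemma pairing_trans t x c : pairing t (ctrans x c) = pairing (fun E => t (x *: E)) c.
Proof.
rewrite /pairing (reindex_inj (@lcoset_inj _ x)) /=; apply: eq_bigr => E _.
by rewrite ffunE lcosetK.
Qed.

Definition delta E : chain := [ffun F => (F == E)%:R]%R.

Lemma pairing_delta t E : pairing t (delta E) = t E.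
Proof.
rewrite /pairing (bigD1 E) //= ffunE eqxx mulr1 big1 ?addr0 // => F /negPf FE.
by rewrite ffunE FE mulr0.
Qed.

Lemma ctrans_delta x E : ctrans x (delta E) = delta (x *: E).
Proof.
apply/ffunP=> F; rewrite !ffunE; congr (_%:R)%R; congr (nat_of_bool _).
apply/eqP/eqP => [<-|->].
  by rewrite lcosetKV.
by rewrite lcosetK.
Qed.

End Chains.

(** * Finite p-quotients *)

(** Surjectivity is left to [onto_image_quotient], so that products and twisted extensions directly
    give new quotients. *)
Record pquotient (p : nat) (G : groupType) := PQuotient {
  pq_group : finGroupType;
  pq_fun :> G -> pq_group;
  pq_morphM : {morph pq_fun : x y / x * y};
  pq_pgroup : p.-group [set: pq_group] }.

Fact pq_morph1 p G (psi : pquotient p G) : psi 1 = 1.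
Proof. by apply: (mulgI (psi 1)); rewrite -pq_morphM !mulg1. Qed.

Lemma pq_morphV p G (psi : pquotient p G) : {morph psi : x / x^-1}.
Proof. by move=> x; apply: (mulgI (psi x)); rewrite -pq_morphM !mulgV pq_morph1. Qed.

Section PQuotients.

Variables (p : nat) (G : groupType).
Implicit Type psi : pquotient p G.

(** The conjugator is taken in [G] since [psi] may fail to be onto; the form without inverses lets a
    cocycle be evaluated on both sides. *)
Definition conj_in_pquotients (a b : G) :=
  forall psi : pquotient p G, exists g, psi (a * g) = psi (g * b).

Lemma conj_in_pquotients_sym a b :
  conj_in_pquotients a b -> conj_in_pquotients b a.
Proof.
move=> ab psi; have [g e] := ab psi; exists g^-1.
by apply: (mulgI (psi g)); apply: (mulIg (psi g)); rewrite -!pq_morphM !mulgA mulgVK mulgV mul1g.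
Qed.

Lemma conj_in_pquotientsJ a b c d :
  conj_in_pquotients a b -> conj_in_pquotients (a ^ c) (b ^ d).
Proof.
move=> ab psi; have [g e] := ab psi; exists (c^-1 * g * d).
rewrite !conjgE; have -> : c^-1 * (a * c) * (c^-1 * g * d) = c^-1 * (a * g) * d.
  by rewrite !mulgA mulgK.
have -> : c^-1 * g * d * (d^-1 * (b * d)) = c^-1 * (g * b) * d by rewrite !mulgA mulgK.
by rewrite 2!pq_morphM e -!pq_morphM.
Qed.

Hypothesis residual : forall g : G, g != 1 -> exists psi : pquotient p G, psi g != 1.

(** A finite product of quotients, each detecting one element of [s], is again a [p]-quotient. *)
Lemma pquotient_faithful_on (s : seq G) :
  exists psi : pquotient p G, forall g, g \in s -> psi g = 1 -> g = 1.
Proof.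
elim: s => [|x s [psi IHs]].
  have p1 : p.-group [set: 'I_1] by rewrite /pgroup cardsT card_ord.
  have f1 : {morph (fun=> 1 : 'I_1) : x y / (x : G) * y >-> x * y} by move=> x y; rewrite mulg1.
  by exists (PQuotient f1 p1).
have [->|/residual[chi chix]] := eqVneq x 1.
  by exists psi => g /[!inE]/orP[/eqP // | /IHs].
have pX : p.-group [set: pq_group psi * pq_group chi].
  rewrite /pgroup cardsT card_prod pnatM -!cardsT.
  by apply/andP; split; apply: pq_pgroup.
have fM : {morph (fun g => (psi g, chi g)) : x y / x * y} by move=> y z /=; rewrite !pq_morphM.
exists (PQuotient fM pX) => g /[!inE] gs e.
have [psi1 chi1] : (psi g, chi g) = (1, 1) := e.
case/orP: gs => [/eqP gx | /IHs]; last exact.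
by move/eqP: chix; rewrite -gx.
Qed.

End PQuotients.

(** * Residually p amalgams of finite groups *)

Section Amalgam.

Variables (p : nat) (G : groupType) (V : bool -> seq G) (A : seq G).

Definition subgroup_seq (s : seq G) :=
  [/\ 1 \in s, {in s &, forall x y, x * y \in s} & {in s, forall x, x^-1 \in s}].

(* [V false] and [V true] list the images of H and K in G, and [A] that of their common
   subgroup. *)
Record residually_p_amalgam : Prop := ResiduallyPAmalgam {
  amalgam_prime : prime p;
  factor_subgroup : forall b, subgroup_seq (V b);
  base_subgroup : subgroup_seq A;
  base_sub_factor : forall b, {subset A <= V b};
  factor_torsion : forall b, {in V b, forall x, exists2 m, 0 < m & x ^+ m = 1};
  factor_generate : forall Q : G -> Prop, (forall b, {in V b, forall x, Q x}) ->
    (forall x y, Q x -> Q y -> Q (x * y)) -> forall x, Q x;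
  amalgam_universal : forall (W : finGroupType) (f : bool -> G -> W),
    (forall b, {in V b &, {morph f b : x y / x * y}}) ->
    {in A, f false =1 f true} ->
    exists h : G -> W, {morph h : x y / x * y} /\ forall b, {in V b, h =1 f b};
  amalgam_residual : forall g : G, g != 1 -> exists psi : pquotient p G, psi g != 1 }.

Hypothesis GVA : residually_p_amalgam.
Implicit Types (b : bool) (psi : pquotient p G) (s : seq G).

Let V1 b : 1 \in V b. Proof. by case: (factor_subgroup GVA b). Qed.
Let VM b x y : x \in V b -> y \in V b -> x * y \in V b.
Proof. by case: (factor_subgroup GVA b) => _ VbM _; apply: VbM. Qed.
Let VV b x : x \in V b -> x^-1 \in V b.
Proof. by case: (factor_subgroup GVA b) => _ _; apply. Qed.
Let VJ b x y : x \in V b -> y \in V b -> x ^ y \in V b.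
Proof. by move=> xV yV; apply: VM (VV yV) _; apply: VM. Qed.
Let A1 : 1 \in A. Proof. by case: (base_subgroup GVA). Qed.
Let AM x y : x \in A -> y \in A -> x * y \in A.
Proof. by case: (base_subgroup GVA) => _ AAM _; apply: AAM. Qed.
Let AV x : x \in A -> x^-1 \in A.
Proof. by case: (base_subgroup GVA) => _ _; apply. Qed.
Let AsV b x : x \in A -> x \in V b. Proof. exact: (base_sub_factor GVA). Qed.

Lemma subgroup_seqMl s x y : subgroup_seq s -> x \in s -> (x * y \in s) = (y \in s).
Proof.
move=> [_ sM sV] ys; apply/idP/idP => [xys | xs]; last exact: sM.
by rewrite -(mulKg x y) sM ?sV.
Qed.

Lemma subgroup_seqV s x : subgroup_seq s -> (x^-1 \in s) = (x \in s).
Proof.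
by move=> [_ _ sV]; apply/idP/idP => xs; [rewrite -(invgK x)|]; apply: sV.
Qed.

(** * Cosets in a quotient and the edge cocycle *)

Definition pimage psi s : {set pq_group psi} := [set y in map psi s].

Lemma mem_pimage psi s x : x \in s -> psi x \in pimage psi s.
Proof. by move=> xs; rewrite inE map_f. Qed.

Lemma pimageP psi s y : reflect (exists2 x, x \in s & y = psi x) (y \in pimage psi s).
Proof. by rewrite inE; apply: mapP. Qed.

Lemma pimage_lcoset psi s x y : subgroup_seq s ->
  (psi x *: pimage psi s == psi y *: pimage psi s) = (psi (x^-1 * y) \in pimage psi s).
Proof.
move=> [s1 sM sV]; apply/eqP/idP => [e | /pimageP[z zs e]].
  rewrite pq_morphM pq_morphV -mem_lcoset e mem_lcoset mulVg -(pq_morph1 psi).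
  exact: mem_pimage.
have {e}-> : psi y = psi x * psi z by rewrite -e -pq_morphM mulVKg.
rewrite lcosetM; congr (_ *: _); apply/setP=> u; rewrite mem_lcoset.
apply/pimageP/pimageP => [[v vs ->] | [v vs e]].
  by exists (z^-1 * v); rewrite ?sM ?sV // pq_morphM pq_morphV.
by exists (z * v); rewrite ?sM // pq_morphM -e mulVKg.
Qed.

Notation base psi := (pimage psi A).

(** In coset terms, multiplying an edge by the image of [V b] gives its endpoint of type [b]. *)
Lemma base_mul_factor psi b x :
  (psi x *: base psi) * pimage psi (V b) = psi x *: pimage psi (V b).
Proof.
rewrite -mulgA; congr (_ * _); apply/setP=> y.
apply/idP/pimageP => [/mulsgP[_ _ /pimageP[u uA ->] /pimageP[v vV ->] ->] | [v vV ->]].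
  by exists (u * v); [apply: VM => //; apply: AsV | rewrite pq_morphM].
by rewrite -[psi v]mul1g mem_mulg -?(pq_morph1 psi) ?mem_pimage.
Qed.

(* For [x] in [V true], the path from the vertex of [V false] to its translate by [x] runs
   along the edge [base psi] and back along the translate of that edge. *)
Record edge_cocycle (R : finNzRingType) psi (c : G -> chain R (pq_group psi)) : Prop :=
  EdgeCocycle {
  cocycleM : forall x y, c (x * y)%g = (c x + ctrans (psi x) (c y))%R;
  cocycle_false : forall x, x \in V false -> c x = 0%R;
  cocycle_true : forall x, x \in V true ->
    c x = (delta R (base psi) - delta R (psi x *: base psi)%g)%R }.

(** The conjugacy hypothesis is applied to the homomorphism into the twisted extension, so one [g]
    serves both [psi] and its cocycle. *)
Lemma exists_edge_cocycle (R : finNzRingType) psi : p.-nat #|R| ->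
  exists2 c : G -> chain R (pq_group psi), edge_cocycle c &
    forall x y, conj_in_pquotients p x y ->
      exists2 g, psi (x * g) = psi (g * y) & c (x * g) = c (g * y).
Proof.
move=> pR; set D := base psi.
(* [f true x] is [(0, psi x)] conjugated by the base edge; it agrees with [f false x] on [A] because
   the image of [A] fixes that edge. *)
pose f b x : twist R (pq_group psi) :=
  ((if b then delta R D - delta R (psi x *: D)%g else 0)%R, psi x).
have fM b : {in V b &, {morph f b : x y / x * y}}.
  move=> x y _ _; rewrite /f pq_morphM twistE /=; case: b; congr (_, _).
    by rewrite ctransD ctransN !ctrans_delta lcosetM addrA subrK.
  by apply/ffunP=> E; rewrite !ffunE addr0.
have fA : {in A, f false =1 f true}.
  move=> x xA; rewrite /f (_ : psi x *: D = D) ?subrr //.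
  rewrite -[RHS]lcoset1 -(pq_morph1 psi); apply/eqP.
  by rewrite pimage_lcoset ?mulg1 ?mem_pimage ?AV //; apply: base_subgroup GVA.
have [h [hM hV]] := amalgam_universal GVA fM fA.
have h2 x : (h x).2 = psi x.
  elim/(factor_generate GVA): x => [b x xV | x y hx hy]; first by rewrite (hV _ _ xV).
  by rewrite hM pq_morphM twistE /= hx hy.
exists (fun x => (h x).1) => [|x y xy].
  split=> [x y|x xV|x xV]; last by rewrite (hV _ _ xV).
    by rewrite hM twistE /= h2.
  by rewrite (hV _ _ xV).
have [g e] := xy (PQuotient hM (twist_pgroup pR (pq_pgroup psi))).
by exists g; [rewrite -!h2; congr (_.2) | congr (_.1)].
Qed.

Section Cocycle.

Variables (R : finNzRingType) (psi : pquotient p G).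
Variables (c : G -> chain R (pq_group psi)) (Cc : edge_cocycle c).
Implicit Types t : {set pq_group psi} -> R.

Lemma pairing_cocycleM t x y :
  (pairing t (c (x * y)%g) = pairing t (c x) + pairing (fun E => t (psi x *: E)%g) (c y))%R.
Proof. by rewrite (cocycleM Cc) pairingD pairing_trans. Qed.

Lemma pairing_cocycle_false t x : x \in V false -> pairing t (c x) = 0%R.
Proof. by move=> /(cocycle_false Cc)->; rewrite pairing0. Qed.

Lemma pairing_cocycle_true t x : x \in V true ->
  (pairing t (c x) = t (base psi) - t (psi x *: base psi)%g)%R.
Proof. by move=> /(cocycle_true Cc)->; rewrite pairingD pairingN !pairing_delta. Qed.

End Cocycle.

(** * Reduced words and normal forms *)

Fixpoint reduced b s :=
  if s is x :: s' then [&& x \in V b, x \notin A & reduced (~~ b) s'] else true.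

Notation word s := (\prod_(x <- s) x).

Lemma reduced_cat b s1 s2 :
  reduced b (s1 ++ s2) = reduced b s1 && reduced (b (+) odd (size s1)) s2.
Proof.
elim: s1 b => [|x s1 IHs] b /=; first by rewrite addbF.
by rewrite IHs -!andbA; case: b; case: (odd _).
Qed.

Lemma reduced_rcons b s x : reduced b (rcons s x) =
  [&& reduced b s, x \in V (b (+) odd (size s)) & x \notin A].
Proof. by rewrite -cats1 reduced_cat /= andbT. Qed.

Lemma reduced_inv b s :
  reduced b s -> reduced (b (+) ~~ odd (size s)) (rev [seq x^-1 | x <- s]).
Proof.
elim: s b => //= x s IHs b /and3P[xV xA /IHs sr].
rewrite rev_cons reduced_rcons size_rev size_map (subgroup_seqV _ (base_subgroup GVA)) xA.
have -> : b (+) ~~ ~~ odd (size s) = ~~ b (+) ~~ odd (size s) by case: b {xV sr}; case: odd.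
by rewrite sr andbT; have -> : ~~ b (+) ~~ odd (size s) (+) odd (size s) = b;
  [case: b {xV sr}; case: odd | apply: VV].
Qed.

Lemma word_inv s : word (rev [seq x^-1 | x <- s]) = (word s)^-1 :> G.
Proof.
elim: s => [|x s IHs]; first by rewrite !big_nil invg1.
by rewrite rev_cons -cats1 big_cat big_seq1 big_cons /= IHs invgM.
Qed.

(** The cocycle of a word involves only the base edge and its translates by nonempty prefixes. The
    hypothesis kills the translates, and the base edge enters only through a first letter in
    [V true]. *)
Lemma pairing_cocycle_word (R : finNzRingType) psi (c : G -> chain R (pq_group psi)) t b s :
  edge_cocycle c -> reduced b s ->
  (forall k, 0 < k <= size s -> t (psi (word (take k s)) *: base psi) = 0%R) ->
  pairing t (c (word s)) = (if b && (s != [::]) then t (base psi) else 0)%R.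
Proof.
move=> Cc; elim: s b t => [|x s IHs] b t /=.
  by rewrite andbF big_nil => _ _; apply: pairing_cocycle_false (V1 _).
case/and3P=> xV xA sr t0.
have tx : t (psi x *: base psi) = 0%R.
  by have := t0 1%N; rewrite /= take0 big_seq1; apply.
rewrite big_cons pairing_cocycleM // (IHs (~~ b)) // => [|k /andP[k0 ks]]; last first.
  by have := t0 k.+1; rewrite /= big_cons pq_morphM -lcosetM; apply.
case: b xV {sr} => xV /=; last first.
  by rewrite (pairing_cocycle_false Cc) // tx if_same addr0.
by rewrite (pairing_cocycle_true Cc) // tx subr0 addr0.
Qed.

(* In a shortest counterexample the first edge of the path spelled by the word is passed only
   once, so it has coefficient 1 or -1 in the cocycle; but the cocycle vanishes on [A]. *)
Lemma reduced_word_notin_base b s : reduced b s -> s != [::] -> word s \notin A.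
Proof.
have p_pr := amalgam_prime GVA.
have [n] := ubnP (size s); elim: n s b => // n IHn [|x s] b //= /ltnSE sn.
case/and3P=> xV xA sr _; apply/negP => sA.
(* Faithfulness on these products forces [q] into [A] as soon as [psi q] lies in the image of
   [A]. *)
pose T := [seq q * a | q <- x :: [seq word (take k s) | k <- iota 0 (size s).+1], a <- A].
have [psi psiP] := pquotient_faithful_on (amalgam_residual GVA) T.
have notbase q : q \in x :: [seq word (take k s) | k <- iota 0 (size s).+1] ->
    q \notin A -> psi q \notin base psi.
  move=> qT; apply: contra => /pimageP[a aA e].
  suff /divg1_eq -> : q * a^-1 = 1 by [].
  apply: psiP; first by apply: allpairs_f => //; apply: AV.
  by rewrite pq_morphM pq_morphV e mulgV.
have pZp : p.-nat #|'F_p|.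
  by rewrite card_Fp ?pnat_id ?(amalgam_prime GVA).
have [c Cc _] := exists_edge_cocycle psi pZp.
pose t E : 'F_p := ((E == psi x *: base psi)%g%:R)%R.
have tE q : t (psi q *: base psi) = ((psi (x^-1 * q) \in base psi)%g%:R)%R.
  by rewrite /t eq_sym pimage_lcoset //; apply: base_subgroup GVA.
have := pairing_cocycle_false Cc t (AsV false sA).
rewrite big_cons pairing_cocycleM //.
rewrite (pairing_cocycle_word Cc sr) => [|k /andP[k0 ks]]; last first.
  rewrite -lcosetM -pq_morphM tE mulKg (negPf (notbase _ _ _)) //.
    by rewrite inE map_f ?orbT // mem_iota.
  have := IHn (take k s) (~~ b); apply.
  - by rewrite size_take_min; apply: leq_ltn_trans sn; apply: geq_minr.
  - by move: sr; rewrite -{1}(cat_take_drop k s) reduced_cat => /andP[].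
  - by rewrite -size_eq0 size_takel // -lt0n.
have tx : t (psi x *: base psi) = 1%R by rewrite /t eqxx.
(* The edge [psi x *: base psi] enters with coefficient -1 through [x] if [x] is in [V true], and
   otherwise with coefficient 1 through the next letter, which exists since [x] is not in [A]. *)
rewrite /= tx; case: b xV sr => xV sr /=.
  rewrite (pairing_cocycle_true Cc) // tx addr0 /t -{1}[base psi]lcoset1 -(pq_morph1 psi).
  rewrite pimage_lcoset; last exact: base_subgroup GVA.
  rewrite invg1 mul1g (negPf (notbase _ _ _)) ?inE ?eqxx //.
  by rewrite sub0r => /eqP; rewrite oppr_eq0 oner_eq0.
rewrite (pairing_cocycle_false Cc) // add0r; case: s {IHn sn notbase psiP T} sr sA => [|y s] sr.
  by rewrite big_seq1 (negPf xA).
by rewrite /= => _ /eqP; rewrite oner_eq0.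
Qed.

(** The excluded factor is the one where the next letter would lie. If it contained the word,
    appending the inverse of the word would give a reduced word with product 1. *)
Lemma reduced_word_notin_factor b s :
  reduced b s -> s != [::] -> word s \notin V (b (+) odd (size s)).
Proof.
case/lastP: s => // s x sxr _; apply/negP; set u := word _ => uV.
have [uA | uA] := boolP (u \in A).
  by have := reduced_word_notin_base sxr; rewrite uA -size_eq0 size_rcons => /(_ isT).
have : reduced b (rcons (rcons s x) u^-1).
  by rewrite reduced_rcons sxr VV // (subgroup_seqV _ (base_subgroup GVA)).
move/reduced_word_notin_base; rewrite -size_eq0 size_rcons => /(_ isT).
by rewrite -cats1 big_cat big_seq1 /= -/u mulgV A1.
Qed.

Lemma word_nseq s m : word (flatten (nseq m s)) = word s ^+ m :> G.
Proof.
by elim: m => [|m IHm]; rewrite ?big_nil // big_cat IHm expgS.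
Qed.

Lemma cyc_reduced_word_expg b s m : reduced b s -> ~~ odd (size s) -> s != [::] ->
  0 < m -> word s ^+ m != 1.
Proof.
move=> sr se sN0 m0; rewrite -word_nseq.
have rm k : reduced b (flatten (nseq k s)).
  by elim: k => //= k IHk; rewrite reduced_cat sr (negPf se) addbF.
apply: contraNneq (reduced_word_notin_base (rm m) _) => [->|] //.
by case: m m0 => // m _; case: s sN0 {sr se rm}.
Qed.

(** If the types differed, the inverse of [s1] followed by [s2], with [u] absorbed into the first
    letter of [s2], would be a reduced word with product [u]. *)
Lemma word_conj_base b1 b2 s1 s2 u : reduced b1 s1 -> reduced b2 s2 ->
  s2 != [::] -> ~~ odd (size s1) -> ~~ odd (size s2) ->
  u \in A -> word s1 * u = u * word s2 -> b1 = b2.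
Proof.
move=> r1 r2; case: s2 r2 => //= x s2 /and3P[xV xA r2] _ e1 e2 uA.
rewrite big_cons => e; apply/eqP/negPn/negP => b12.
have {}b12 : b2 = ~~ b1 by case: b1 b2 b12 {r1 r2 xV} => [] [].
have := @reduced_word_notin_factor (~~ b1) (rev [seq y^-1 | y <- s1] ++ u * x :: s2).
rewrite reduced_cat size_rev size_map (negPf e1) addbF /= -b12.
have := reduced_inv r1; rewrite e1 addbT -b12 r2 => -> /=.
rewrite (VM (AsV _ uA) xV) (subgroup_seqMl _ (base_subgroup GVA)) // xA => /(_ isT).
rewrite size_cat size_rev size_map oddD /= (negPf e1) (negPf e2) addbF.
rewrite big_cat big_cons word_inv /= -mulgA -e mulKg AsV // => H.
by case: (rev _) H => [|? ?] /(_ isT).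
Qed.

(** Otherwise this element joins the inverse of [s1] to [s2] in a reduced word of odd length, which
    starts and ends outside [V b] but has product [u] in [V b]. *)
Lemma word_conj_factor b x1 s1 x2 s2 u : reduced b (x1 :: s1) -> reduced b (x2 :: s2) ->
  odd (size s1) -> odd (size s2) -> u \in V b ->
  word (x1 :: s1) * u = u * word (x2 :: s2) -> x1^-1 * u * x2 \in A.
Proof.
move=> /= /and3P[x1V _ r1] /and3P[x2V _ r2] o1 o2 uV; rewrite !big_cons => e.
apply/negPn/negP; set v := _ * x2 => vA.
have := @reduced_word_notin_factor (~~ b) (rev [seq y^-1 | y <- s1] ++ v :: s2).
rewrite reduced_cat size_rev size_map o1 /= vA addNb addbT negbK r2.
have := reduced_inv r1; rewrite o1 addbF => -> /=.
rewrite !VM ?VV // size_cat size_rev size_map oddD /= o1 o2 /= addbT negbK.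
rewrite big_cat big_cons word_inv /= /v -!mulgA -e !mulgA mulgVK mulVg mul1g uV => H.
by case: (rev _) H => [|? ?] /(_ isT isT).
Qed.

(** * Cyclic reduction *)

Fixpoint alternating b s :=
  if s is x :: s' then (x \in V b) && alternating (~~ b) s' else true.

Lemma alternating_cat b s1 s2 :
  alternating b (s1 ++ s2) = alternating b s1 && alternating (b (+) odd (size s1)) s2.
Proof.
elim: s1 b => [|x s1 IHs] b /=; first by rewrite addbF.
by rewrite IHs -!andbA; case: b; case: (odd _).
Qed.

Lemma reduced_alternating b s : reduced b s = alternating b s && ~~ has (mem A) s.
Proof.
elim: s b => //= x s IHs b; rewrite IHs negb_or.
by case: (x \in V b); case: (x \in A); rewrite ?andbF.
Qed.

(** Padding a single letter with 1 gives an even word starting in [V true], and such words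
    concatenate. *)
Lemma factor_alternating g :
  exists s, [/\ alternating true s, ~~ odd (size s) & g = word s].
Proof.
elim/(factor_generate GVA): g => [[] x xV | x y [s [sa se ->]] [t [ta te ->]]].
- exists [:: x; 1]; split=> //=; first by rewrite xV V1.
  by rewrite big_cons big_seq1 mulg1.
- exists [:: 1; x]; split=> //=; first by rewrite xV V1.
  by rewrite big_cons big_seq1 mul1g.
exists (s ++ t); rewrite alternating_cat sa (negPf se) ta; split=> //.
  by rewrite size_cat oddD (negPf se).
by rewrite big_cat.
Qed.

Definition cyc_reduced g :=
  exists s, [/\ reduced true s, ~~ odd (size s), s != [::] & g = word s].

Lemma word_catJ s1 s2 : word (s1 ++ s2) ^ word s1 = word (s2 ++ s1) :> G.
Proof. by rewrite !big_cat conjgE /= -!mulgA mulKg. Qed.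

(** A letter in [A] can be rotated to the front; conjugation then merges it with its two cyclic
    neighbours, which lie in the same factor, and the word shrinks by two letters. *)
Lemma conj_factor_or_cyc_reduced g :
  exists c, (exists b, g ^ c \in V b) \/ cyc_reduced (g ^ c).
Proof.
suff words n b s : size s < n -> alternating b s -> ~~ odd (size s) ->
    exists c, (exists b', word s ^ c \in V b') \/ cyc_reduced (word s ^ c).
  by have [s [sa se ->]] := factor_alternating g; apply: (words (size s).+1 true).
elim: n b s => // n IHn b s /ltnSE sn sa se.
have [sr | ] := boolP (reduced b s).
  case: b s sr se {sa sn} => [] [|x s] sr se.
  - by exists 1; left; exists true; rewrite big_nil conj1g.
  - by exists 1; right; exists (x :: s); rewrite conjg1.
  - by exists 1; left; exists true; rewrite big_nil conj1g.
  exists (word [:: x]); right; exists (s ++ [:: x]); split.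
  - move: sr => /= /and3P[xV xA sr]; rewrite reduced_cat sr /= xA.
    by move: se => /=; rewrite negbK andbT => ->.
  - by move: se; rewrite size_cat addn1.
  - by case: (s).
  by rewrite -[x :: s]/([:: x] ++ s) word_catJ.
rewrite reduced_alternating sa /= negbK => /hasP[x xs /= xA].
case/splitPr: xs sn sa se => s1 s2; set b' := b (+) odd (size s1).
suff: forall t, size t < n -> alternating b' (x :: t) -> odd (size t) ->
    exists c, (exists b, word (x :: t) ^ c \in V b) \/ cyc_reduced (word (x :: t) ^ c).
  move=> IH sn sa se; have [|||c IHc] := IH (s2 ++ s1).
  - by move: sn; rewrite !size_cat /= addnS addnC.
  - move: sa; rewrite alternating_cat /= -/b' => /and3P[s1a -> s2a] /=.
    rewrite alternating_cat s2a /=; move: se; rewrite size_cat oddD /= /b'.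
    by move: s1a; case: (odd (size s1)); case: (odd (size s2)); case: (b).
  - by move: se; rewrite !size_cat !oddD /=; case: odd; case: odd.
  by exists (word s1 * c); rewrite conjgM word_catJ.
move=> t; move: b' => {}b.
case: t => // y t; case/lastP: t => [|t z] tn /= /and3P[xV yV ta] te.
  exists 1; left; exists (~~ b).
  by rewrite conjg1 big_cons big_seq1; apply: VM => //; apply: AsV.
move: ta te; rewrite -cats1 alternating_cat size_cat addn1 /= andbT !negbK => /andP[ta zV] te.
rewrite te addbT in zV.
have [|||c IHc] := IHn (~~ b) (z * x * y :: t).
- by move: tn; rewrite /= size_rcons; apply: ltnW.
- by rewrite /= negbK ta !VM // AsV.
- by rewrite /= te.
exists (z^-1 * c); rewrite conjgM; suff -> : word (x :: y :: t ++ [:: z]) ^ z^-1 =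
  word (z * x * y :: t) by [].
by rewrite !big_cons big_cat big_seq1 conjgE invgK /= !mulgA mulgK.
Qed.

(** * Conjugacy of elliptic elements *)

Lemma eq_pairing (R : finNzRingType) (P : finGroupType) (t1 t2 : {set P} -> R) c :
  t1 =1 t2 -> pairing t1 c = pairing t2 c.
Proof. by move=> t12; apply: eq_bigr => E _; rewrite t12. Qed.

Lemma lcoset_perm_elt (P : finGroupType) (a : P) :
  p.-elt a -> p.-elt (perm (@lcoset_inj P a)).
Proof.
move=> pa; apply: pnat_dvd pa; rewrite order_dvdn; apply/eqP/permP=> E.
suff -> k : (perm (@lcoset_inj P a) ^+ k) E = a ^+ k *: E by rewrite expg_order lcoset1 perm1.
elim: k => [|k IHk]; first by rewrite perm1 lcoset1.
by rewrite expgSr permM IHk permE -lcosetM -expgS.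
Qed.

Section Elliptic.

Variables (psi : pquotient p G) (x : G).
Hypothesis psi_inj : forall g, g \in V false ++ V true -> psi g = 1 -> g = 1.

Let MV b := pimage psi (V b).
Let D := base psi.
Let alpha := psi x.

Lemma pquotient_factor_inj b : {in V b &, injective psi}.
Proof.
move=> u v uV vV e; apply: divg1_eq; apply: psi_inj; last first.
  by rewrite pq_morphM pq_morphV e mulgV.
have: u * v^-1 \in V b by apply: VM => //; apply: VV.
by rewrite mem_cat; case: (b) => ->; rewrite ?orbT.
Qed.

(* Images of the vertices of type [b] of the tree of cosets that are fixed by [x]. *)
Definition fixed_vertex b (E : {set pq_group psi}) : bool :=
  `[< exists2 z, E = psi z *: MV b & x ^ z \in V b >].

Lemma fixed_vertexP b g :
  reflect (exists2 z, psi z = psi g & x ^ z \in V b) (fixed_vertex b (psi g *: MV b)).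
Proof.
apply: (iffP (asboolP _)) => [[z e zV] | [z <- zV]]; last by exists z.
move/eqP: e; rewrite eq_sym pimage_lcoset; last exact: factor_subgroup GVA b.
case/pimageP=> v vV e; exists (z * v).
  by rewrite pq_morphM -e pq_morphM pq_morphV mulVKg.
by rewrite conjgM VJ.
Qed.

Lemma fixed_vertex_trans b E : fixed_vertex b (alpha *: E) = fixed_vertex b E.
Proof.
apply/asboolP/asboolP => [[z e zV] | [z -> zV]].
  exists (x^-1 * z); last by rewrite conjgM [x ^ x^-1]conjgE mulgV mulg1 invgK.
  by rewrite pq_morphM pq_morphV lcosetM -e lcosetK.
exists (x * z); last by rewrite conjgM [x ^ x]conjgE mulKg.
by rewrite pq_morphM lcosetM.
Qed.

Definition is_edge (E : {set pq_group psi}) : bool := `[< exists z, E = psi z *: D >].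

Lemma is_edge_trans E : is_edge (alpha *: E) = is_edge E.
Proof.
apply/asboolP/asboolP => [[z e] | [z ->]].
  by exists (x^-1 * z); rewrite pq_morphM pq_morphV lcosetM -e lcosetK.
by exists (x * z); rewrite pq_morphM lcosetM.
Qed.

(** The coboundary of the indicator function of the fixed vertices, extended by 0 to subsets that
    are not edges. *)
Definition fixed_diff (E : {set pq_group psi}) : 'F_p :=
  if is_edge E then
    ((fixed_vertex true (E * MV true)%g)%:R - (fixed_vertex false (E * MV false)%g)%:R)%R
  else 0%R.

Let tau b g : 'F_p := ((fixed_vertex b (psi g *: MV b)%g)%:R)%R.

Lemma fixed_diff_edge z : fixed_diff (psi z *: D) = (tau true z - tau false z)%R.
Proof.
rewrite /fixed_diff ifT ?base_mul_factor //; apply/asboolP.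
by exists z.
Qed.

Lemma fixed_diff_trans E : fixed_diff (alpha *: E) = fixed_diff E.
Proof. by rewrite /fixed_diff is_edge_trans -!mulgA !fixed_vertex_trans. Qed.

(** If one end of the edge comes from a vertex fixed by [x], the corresponding conjugate of [x] has
    image in that of [A]. Injectivity on the factor puts it in [A], so the other end is fixed
    too. *)
Lemma fixed_diff0 E : alpha *: E = E -> fixed_diff E = 0%R.
Proof.
rewrite /fixed_diff; case: ifP => // /asboolP[z ->] e; apply/eqP.
rewrite subr_eq0 !base_mul_factor; apply/eqP; congr (_%:R)%R; congr nat_of_bool.
have swap b : fixed_vertex b (psi z *: MV b) -> fixed_vertex (~~ b) (psi z *: MV (~~ b)).
  case/fixed_vertexP=> y yz yV; apply/fixed_vertexP; exists y => //.
  move/eqP: e; rewrite -lcosetM -yz -pq_morphM eq_sym.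
  rewrite pimage_lcoset; last exact: base_subgroup GVA.
  case/pimageP=> u uA; rewrite -conjgE => e; apply: AsV.
  by rewrite (pquotient_factor_inj yV _ e) ?AsV.
by apply/idP/idP => /swap.
Qed.

Lemma tau_mulr b z v : v \in V b -> tau b (z * v) = tau b z.
Proof.
move=> vV; rewrite /tau; congr (_%:R)%R; congr nat_of_bool; congr (fixed_vertex b _).
apply/eqP; rewrite eq_sym pimage_lcoset; last exact: factor_subgroup GVA b.
by rewrite mulKg mem_pimage.
Qed.

(** A coboundary telescopes along the path from the vertex of [z] to that of [z * g], both of type
    [false]. *)
Lemma pairing_fixed_diff (c : G -> chain 'F_p (pq_group psi)) g z : edge_cocycle c ->
  pairing (fun E => fixed_diff (psi z *: E)) (c g) = (tau false (z * g) - tau false z)%R.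
Proof.
move=> Cc; elim/(factor_generate GVA): g z => [[] v vV z | g h IHg IHh z].
- rewrite (pairing_cocycle_true Cc) // -lcosetM -pq_morphM !fixed_diff_edge tau_mulr //.
  by ring.
- by rewrite (pairing_cocycle_false Cc) // tau_mulr // subrr.
rewrite (pairing_cocycleM Cc) IHg mulgA.
rewrite (eq_pairing _ (t2 := fun E => fixed_diff (psi (z * g) *: E))) ?IHh; first by ring.
by move=> E; rewrite pq_morphM lcosetM.
Qed.

End Elliptic.

Lemma factor_conj_of_pquotients b1 b2 x y : x \in V b1 -> y \in V b2 ->
  conj_in_pquotients p x y -> exists c, x ^ c = y.
Proof.
move=> xV yV xy; have p_pr := amalgam_prime GVA.
have [psi psi_inj] := pquotient_faithful_on (amalgam_residual GVA) (V false ++ V true).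
have pZp : p.-nat #|'F_p| by rewrite card_Fp ?pnat_id.
have [c Cc /(_ _ _ xy)[g e ce]] := exists_edge_cocycle psi pZp.
(* [eb b] is the chain of the path from the base vertex of type [false] to the one of type [b]. *)
pose eb (b : bool) : chain 'F_p (pq_group psi) := (if b then delta _ (base psi) else 0)%R.
have cV b u : u \in V b -> c u = (eb b - ctrans (psi u) (eb b))%R.
  case: b => uV; first by rewrite (cocycle_true Cc) // ctrans_delta.
  by rewrite (cocycle_false Cc) //; apply/ffunP=> E; rewrite !ffunE subr0.
(* The chain of a path from the vertex fixed by [x] to the one fixed by [g y g^-1]. *)
pose r := (c g + ctrans (psi g) (eb b2) - eb b1)%R.
have rx : ctrans (psi x) r = r.
  move: ce; rewrite !(cocycleM Cc) (cV b1 x) // (cV b2 y) // !ctransD !ctransN.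
  rewrite -!ctransM -pq_morphM -e pq_morphM ctransM => /ffunP ce.
  have solve (s1 s2 s3 t1 t2 t3 : 'F_p) :
      (s1 - s2 + s3 = t1 + (t2 - t3) -> s3 + t3 - s2 = t1 + t2 - s1)%R.
    by move=> st; transitivity ((s1 - s2 + s3) + t3 - s1)%R; [|rewrite st]; ring.
  by apply/ffunP=> E; have := ce E; rewrite !ffunE => /solve.
pose f E := (fixed_diff x E * r E)%R.
have : pairing (fixed_diff x) r = 0%R.
  apply: (@sum_perm_invariant p _ (perm (@lcoset_inj _ (psi x))) _ f (pchar_Fp p_pr)).
  - by apply: lcoset_perm_elt; apply: mem_p_elt (pq_pgroup psi) _; rewrite inE.
  - move=> E; rewrite permE /f fixed_diff_trans; congr (_ * _)%R.
    by rewrite -{1}rx ffunE lcosetK.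
  - by move=> E; rewrite permE => /(fixed_diff0 psi_inj); rewrite /f => ->; rewrite mul0r.
have diff1 : fixed_diff x =1 (fun E => fixed_diff x (psi 1 *: E)).
  by move=> E; rewrite pq_morph1 lcoset1.
have pairing_eb b z : pairing (fixed_diff x) (ctrans (psi z) (eb b)) =
    (if b then fixed_diff x (psi z *: base psi)%g else 0)%R.
  rewrite /eb; case: b; first by rewrite ctrans_delta pairing_delta.
  by rewrite (_ : ctrans _ _ = 0%R) ?pairing0 //; apply/ffunP=> E; rewrite !ffunE.
rewrite /r !pairingD pairingN pairing_eb -[eb b1]ctrans1 -(pq_morph1 psi) pairing_eb.
rewrite (eq_pairing _ diff1) (pairing_fixed_diff _ _ _ Cc) !fixed_diff_edge mul1g.
pose tau b z : 'F_p := ((fixed_vertex x b (psi z *: pimage psi (V b)))%g%:R)%R.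
rewrite -/(tau _ g) -/(tau _ 1) => sum0.
(* The pairing telescopes to the difference of [tau] at the two ends of the path, so the far end is
   the image of a fixed vertex as well. *)
have : tau b2 g = tau b1 1.
  apply/eqP; rewrite -subr_eq0; apply/eqP; rewrite -[RHS]sum0.
  by case: (b1); case: (b2); rewrite -/(tau _ g) -/(tau _ 1); ring.
have -> : tau b1 1 = 1%R.
  by rewrite /tau; case: fixed_vertexP => [//|[]]; exists 1; rewrite ?conjg1.
rewrite /tau; case: fixed_vertexP => [[z zg zV] _ | _ /eqP]; last first.
  by rewrite eq_sym oner_eq0.
exists z; apply: (pquotient_factor_inj psi_inj zV yV).
by rewrite conjgE !pq_morphM pq_morphV zg -pq_morphM e pq_morphM mulKg.
Qed.

(** * Conjugacy of hyperbolic elements *)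

Definition prefix (x : nat -> G) n := word (mkseq x n).

(* A periodic path of edges of the tree of cosets, running along the axis of
   [prefix x L]; its edges are the cosets [prefix x i * A]. *)
Definition axis (x : nat -> G) L := [/\ forall i, x i \in V (~~ odd i),
  forall i, x i \notin A, forall i, x (i + L) = x i, ~~ odd L & 0 < L].

Lemma prefix0 x : prefix x 0 = 1. Proof. by rewrite /prefix big_nil. Qed.

Lemma prefixS x n : prefix x n.+1 = prefix x n * x n.
Proof. by rewrite /prefix mkseqS -cats1 big_cat big_seq1. Qed.

Lemma prefixD x i n : prefix x (i + n) = prefix x i * word [seq x k | k <- iota i n].
Proof. by rewrite /prefix /mkseq iotaD map_cat big_cat. Qed.

Lemma reduced_nth b s i : reduced b s -> i < size s ->
  nth 1 s i \in V (b (+) odd i) /\ nth 1 s i \notin A.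
Proof.
elim: s b i => // x s IHs b [|i] /= /and3P[xV xA sr]; first by rewrite addbF.
by rewrite addbN -addNb; apply: IHs.
Qed.

Lemma cyc_reduced_axis g : cyc_reduced g -> exists x L, axis x L /\ g = prefix x L.
Proof.
case=> s [sr se sN0 ->]; have s0 : 0 < size s by rewrite lt0n size_eq0.
have im i : i %% size s < size s by rewrite ltn_mod.
exists (fun i => nth 1 s (i %% size s)), (size s); split.
  split=> // i; last by rewrite modnDr.
    by have [+ _] := reduced_nth sr (im i); rewrite addTb odd_mod // (negPf se).
  by have [] := reduced_nth sr (im i).
rewrite /prefix; congr (word _); rewrite -[LHS](mkseq_nth 1); apply/eq_in_map => i.
by rewrite mem_iota /= => /modn_small->.
Qed.

Section Axis.

Variables (x : nat -> G) (L : nat).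
Hypothesis xL : axis x L.

Lemma segment_reduced i n : reduced (~~ odd i) [seq x k | k <- iota i n].
Proof.
have [xV xA _ _ _] := xL.
by elim: n i => //= n IHn i; rewrite xV xA (IHn i.+1).
Qed.

Lemma prefix_period i : prefix x (i + L) = prefix x L * prefix x i.
Proof.
have [_ _ xp _ _] := xL; elim: i => [|i IHi]; first by rewrite prefix0 mulg1.
by rewrite addSn !prefixS xp IHi mulgA.
Qed.

(** Conjugating [prefix x L] by [prefix x i] gives the period read from [i]; since [t] centralizes
    [prefix x L], the periods read from [i] and [j] differ by conjugation by [u]. *)
Lemma segment_conj t u i j : commute t (prefix x L) -> t * prefix x i = prefix x j * u ->
  word [seq x k | k <- iota j L] * u = u * word [seq x k | k <- iota i L].
Proof.
move=> ta tp; apply: (mulgI (prefix x j)); rewrite !mulgA -prefixD -tp prefix_period.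
by rewrite -mulgA -tp -mulgA -prefixD prefix_period !mulgA ta.
Qed.

Lemma centralizer_axis_parity t u i j : commute t (prefix x L) ->
  t * prefix x i = prefix x j * u -> u \in A -> odd i = odd j.
Proof.
have [_ _ _ Le L0] := xL => ta tp uA.
suff : ~~ odd j = ~~ odd i by move/negb_inj.
apply: (word_conj_base (segment_reduced j L) (segment_reduced i L) _ _ _ uA).
- by rewrite -size_eq0 size_map size_iota -lt0n.
- by rewrite size_map size_iota.
- by rewrite size_map size_iota.
exact: segment_conj ta tp.
Qed.

(** If [t] matches the vertices between edges [i], [i.+1] and [j], [j.+1] of the axis, it must carry
    the outgoing edge [i.+1] to [j.+1]. *)
Lemma centralizer_axis_step t u i j : commute t (prefix x L) ->
  t * prefix x i = prefix x j * u -> odd i = odd j -> u \in V (~~ odd j) ->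
  (x j)^-1 * u * x i \in A.
Proof.
have [_ _ _ Le L0] := xL => ta tp ij uV.
have := segment_conj ta tp; have := segment_reduced j L; have := segment_reduced i L.
case: (L) Le L0 => // n ne _; rewrite ij; move: ne; rewrite /= negbK => ne ri rj.
apply: (word_conj_factor (b := ~~ odd j)) => //; by rewrite size_map size_iota.
Qed.

End Axis.

(** Letters of even index lie in [V true] and contribute two consecutive edges with opposite signs;
    the others contribute nothing. *)
Lemma pairing_cocycle_prefix (R : finNzRingType) psi (c : G -> chain R (pq_group psi)) t y n :
  edge_cocycle c -> (forall i, y i \in V (~~ odd i)) ->
  (pairing t (c (prefix y n.*2)) =
   \sum_(i < n.*2) (-1) ^+ i * t (psi (prefix y i) *: base psi)%g)%R.
Proof.
move=> Cc yV; elim: n => [|n IHn].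
  by rewrite big_ord0 prefix0 (pairing_cocycle_false Cc).
have [e0 e1] := (yV n.*2, yV n.*2.+1); rewrite /= odd_double /= in e0 e1.
rewrite doubleS !big_ord_recr -IHn !prefixS /= !(pairing_cocycleM Cc).
rewrite (pairing_cocycle_true Cc _ e0) (pairing_cocycle_false Cc _ e1) addr0 -addrA.
rewrite exprS -signr_odd odd_double expr0 mulr1 mul1r mulN1r.
by rewrite pq_morphM lcosetM.
Qed.

Section AxisOrbits.

Variables (x : nat -> G) (L : nat) (psi : pquotient p G).
Hypothesis xL : axis x L.
Let a := prefix x L.

(** These are the elements whose commutators with the axis element [psi] has to detect. The bound
    [2 * L] allows a path starting at an edge of index at most [L] to be followed through a full
    period. *)
Definition axis_connectors :=
  [seq prefix x i * vj | i <- iota 0 (2 * L).+1,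
     vj <- [seq v * (prefix x j)^-1 | v <- V false ++ V true, j <- iota 0 L.+1]].

Lemma mem_axis_connectors i j v b : i <= 2 * L -> j <= L -> v \in V b ->
  prefix x i * v * (prefix x j)^-1 \in axis_connectors.
Proof.
move=> iL jL vV; rewrite -mulgA; apply: allpairs_f; first by rewrite mem_iota.
apply: allpairs_f; last by rewrite mem_iota.
by rewrite mem_cat; case: b vV => ->; rewrite ?orbT.
Qed.

Hypothesis psi_commute :
  {in axis_connectors, forall t, commute (psi t) (psi a) -> commute t a}.

Definition axis_orbit b (E : {set pq_group psi}) : bool :=
  `[< exists z i, [/\ commute z (psi a), odd i = b, i <= L &
        E = (z * psi (prefix x i)) *: base psi] >].

Lemma axis_orbit_trans b z E : commute z (psi a) ->
  axis_orbit b (z *: E) = axis_orbit b E.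
Proof.
have imp w F : commute w (psi a) -> axis_orbit b F -> axis_orbit b (w *: F).
  move=> wa /asboolP[v [i [va ib iL ->]]]; apply/asboolP.
  exists (w * v), i; split=> //; last by rewrite -lcosetM mulgA.
  by rewrite /commute -mulgA va !mulgA wa.
move=> za; apply/idP/idP => [zE|]; last exact: imp.
rewrite -[E](lcosetK z); apply: imp zE.
exact/commute_sym/commuteV/commute_sym.
Qed.

(** A common edge yields a connector whose image centralizes [psi a]. It then centralizes [a] itself
    and cannot change the parity along the axis. *)
Lemma axis_orbit_disjoint b E : axis_orbit b E -> axis_orbit (~~ b) E = false.
Proof.
move=> /asboolP[z [i [za ib iL ->]]]; apply/asboolP => -[w [j [wa jb jL]]].
rewrite !lcosetM => /(congr1 (fun F => w^-1 *: F)); rewrite lcosetK => e.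
have : psi (prefix x i) \in z^-1 *: (w *: (psi (prefix x j) *: base psi)).
  rewrite -e lcosetKV lcosetK mem_lcoset mulVg -(pq_morph1 psi); exact: mem_pimage.
rewrite !mem_lcoset invgK => /pimageP[u uA eu].
have tpsi : psi (prefix x j * u * (prefix x i)^-1) = w^-1 * z.
  by rewrite !pq_morphM pq_morphV -eu mulVKg !mulgA mulgK.
have jL2 : j <= 2 * L by rewrite mul2n -addnn (leq_trans jL) ?leq_addr.
have ta : commute (prefix x j * u * (prefix x i)^-1) a.
  apply: psi_commute; first exact: mem_axis_connectors (AsV true uA).
  rewrite tpsi; apply/commute_sym/commuteM; last exact: commute_sym.
  exact/commuteV/commute_sym.
have := centralizer_axis_parity xL ta (mulgVK _ _) uA.
by rewrite ib jb; case: (b).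
Qed.

End AxisOrbits.

Lemma axis_conj_of_pquotients x L y L' : axis x L -> axis y L' -> L' <= L ->
  conj_in_pquotients p (prefix x L) (prefix y L') ->
  exists h, prefix x L ^ h = prefix y L'.
Proof.
move=> xL yL' L'L xy; have p_pr := amalgam_prime GVA.
have [xV xA _ Le L0] := xL; have [yV _ _ L'e _] := yL'.
set a := prefix x L; set a' := prefix y L'.
have [psi psiP] := pquotient_faithful_on (amalgam_residual GVA)
  ([seq [~ t, a] | t <- axis_connectors x L] ++ (V false ++ V true)).
have psi_inj b : {in V b &, injective psi}.
  by apply: pquotient_factor_inj => g gV; apply: psiP; rewrite mem_cat gV orbT.
have psi_commute : {in axis_connectors x L, forall t, commute (psi t) (psi a) -> commute t a}.
  move=> t tT tpsi; apply/commgP/eqP/psiP; first by rewrite mem_cat (map_f (fun t => [~ t, a]) tT).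
  by rewrite commgEl conjgE !pq_morphM !pq_morphV (tpsi : _ * _ = _) mulKg mulVg.
(* The integer shown below to vanish modulo [m] is at most [L + 2 * L'], hence at most [3 * L]. *)
pose m := (p ^ (3 * L))%N.
have m_gt : 3 * L < m by rewrite ltn_expl ?prime_gt1.
have m_gt1 : 1 < m by apply: leq_ltn_trans m_gt; rewrite muln_gt0.
have pm : p.-nat #|'Z_m| by rewrite card_ord Zp_cast // pnatX pnat_id.
have [c Cc /(_ _ _ xy)[g e ce]] := exists_edge_cocycle psi pm.
pose orb := axis_orbit x L.
pose t E : 'Z_m := (if orb psi false E then 1 else if orb psi true E then -1 else 0)%R.
have t_trans E : t (psi a *: E) = t E by rewrite /t /orb !axis_orbit_trans.
have te b E : orb psi b E -> ((-1) ^+ b * t E = 1)%R.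
  rewrite /t; case: b => [Eb|->]; last by rewrite mulr1.
  have /= := axis_orbit_disjoint xL psi_commute Eb; rewrite -/orb => ->.
  by rewrite Eb mulrNN mulr1.
(* The defect of edge [i] of the translated axis of [y]: 0 in an orbit of matching orientation, 2 in
   one of opposite orientation, 1 elsewhere. *)
pose d i := let E := psi (g * prefix y i) *: base psi in
  if orb psi (odd i) E then 0%N else if orb psi (~~ odd i) E then 2%N else 1%N.
have td i : ((-1) ^+ i * t (psi (g * prefix y i) *: base psi)%g = 1 - (d i)%:R)%R.
  rewrite /d -signr_odd /=; set E := _ *: _.
  have [Eb | NEb] := ifPn; first by rewrite te // subr0.
  have [Eb | NEb'] := ifPn.
    have := te _ _ Eb; case: odd; rewrite /= expr0 expr1 mul1r mulN1r => tE.
      by rewrite tE; ring.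
    by rewrite -[t E]opprK tE; ring.
  rewrite /t; case: odd NEb NEb' => /= /negPf-> /negPf->; rewrite mulr0; ring.
have sum_x : pairing t (c a) = L%:R%R.
  have L2 : L./2.*2 = L by rewrite -[RHS]odd_double_half (negPf Le).
  rewrite /a -[L in prefix x L]L2 (pairing_cocycle_prefix _ _ Cc xV) L2.
  rewrite -[L in RHS]card_ord -sumr_const.
  apply: eq_bigr => i _; rewrite -signr_odd te //; apply/asboolP.
  by exists 1, i; rewrite mul1g; split=> //; [apply: commute_sym; apply: commute1 | apply: ltnW].
have sum_y : pairing (fun E => t (psi g *: E)) (c a') = (L'%:R - (\sum_(i < L') d i)%:R)%R.
  have L'2 : L'./2.*2 = L' by rewrite -[RHS]odd_double_half (negPf L'e).
  rewrite /a' -[L' in prefix y L']L'2 (pairing_cocycle_prefix _ _ Cc yV) L'2.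
  rewrite natr_sum -[L' in L'%:R%R]card_ord -sumr_const -sumrB.
  by apply: eq_bigr => i _; rewrite -td pq_morphM lcosetM.
have dsum : (L - L' + \sum_(i < L') d i)%N = 0%N.
  set S := (\sum_(i < L') d i)%N in sum_y *.
  have Sle : S <= 2 * L'.
    rewrite -iter_addn_0 -big_const_ord; apply: leq_sum => i _.
    by rewrite /d; case: ifP => // _; case: ifP.
  have Nm : L - L' + S < m.
    apply: leq_ltn_trans m_gt; apply: leq_trans (leq_add (leq_subr _ _) Sle) _.
    by rewrite (mulSn 2) leq_add2l leq_mul2l L'L orbT.
  suff : ((L - L' + S)%N%:R = 0 :> 'Z_m)%R.
    by move/(congr1 val); rewrite /= val_Zp_nat // modn_small.
  (* Since [t] is invariant under [psi a], the contributions of [c g] on the two sides cancel. *)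
  have := congr1 (pairing t) ce; rewrite !(pairing_cocycleM Cc) (eq_pairing _ t_trans) sum_x sum_y.
  rewrite addrC => /addrI LS.
  by rewrite natrD natrB // LS; ring.
have [LL' d0] : L = L' /\ forall i, i < L -> d i = 0%N.
  move/eqP: dsum; rewrite addn_eq0 subn_eq0 sum_nat_eq0 => /andP[LL' /forallP d0].
  have LL : L = L' by apply/eqP; rewrite eqn_leq LL' L'L.
  by split=> // i; rewrite LL => iL; apply/eqP; apply: (d0 (Ordinal iL)).
subst L'.
(* Index 0 is traded for [L] through a factor [psi a], so that an edge of the axis always has a
   preceding letter. *)
have orb0 i : i < L -> exists z j, [/\ commute z (psi a), odd j = odd i, 0 < j <= L &
    psi (g * prefix y i) *: base psi = (z * psi (prefix x j)) *: base psi].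
  move/d0; rewrite /d; case: ifPn => [+ _ | _]; last by case: ifP.
  case/asboolP=> z [[|j] [za ji jL ->]]; last by exists z, j.+1.
  exists (z * (psi a)^-1), L; rewrite L0 leqnn -ji (negPf Le); split=> //.
    by rewrite /commute mulgVK mulgA -(za : _ * _ = _) mulgK.
  by rewrite mulgVK prefix0 pq_morph1 mulg1.
have {}orb0 i : i <= L -> exists z j, [/\ commute z (psi a), odd j = odd i, 0 < j <= L &
    psi (g * prefix y i) *: base psi = (z * psi (prefix x j)) *: base psi].
  rewrite leq_eqVlt => /orP[/eqP-> | /orb0 //]; rewrite -/a' -e.
  have [z [j [za je jL ze]]] := orb0 0 L0.
  exists (psi a * z), j; rewrite je (negPf Le); split=> //.
    by rewrite /commute -mulgA (za : _ * _ = _).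
  by rewrite pq_morphM -mulgA !lcosetM -[z *: _]lcosetM -ze prefix0 mulg1.
have lift k w : psi k *: base psi = w *: base psi ->
    exists2 u, u \in A & psi k = w * psi u.
  have : psi k \in psi k *: base psi.
    by rewrite mem_lcoset mulVg -(pq_morph1 psi) mem_pimage.
  by move=> kk ek; move: kk; rewrite ek mem_lcoset => /pimageP[u uA eu];
    exists u; rewrite // -eu mulVKg.
have [z0 [j0 [z0a j0e /andP[_ j0L]]]] := orb0 0 (leq0n _).
rewrite prefix0 mulg1 => /lift[u0 u0A gu0].
pose h := prefix x j0 * u0.
have {}gu0 : psi g = z0 * psi h by rewrite gu0 -mulgA -pq_morphM.
have psi_h w : psi (h * w) = z0^-1 * psi (g * w).
  by rewrite (pq_morphM psi h) (pq_morphM psi g) gu0 !mulgA mulVg mul1g.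
(* The path [h * prefix y i], which follows the axis of [a] only up to the centralizer
   of [psi a], genuinely follows it in the tree. *)
have follow i : i <= L ->
    exists2 w, w \in A & h * prefix y i = prefix x (j0 + i) * w.
  elim: i => [_|i IHi iL]; first by exists u0; rewrite // prefix0 mulg1 addn0.
  have [w wA hw] := IHi (ltnW iL).
  have [z [[|j] [za ji /andP[// _ jL]]]] := orb0 i.+1 iL.
  case/lift=> u uA; rewrite -mulgA -pq_morphM => ez.
  have {}ji : odd j = odd i by apply: negb_inj.
  have j0i : odd (j0 + i) = odd i by rewrite oddD j0e.
  pose v := w * y i * u^-1.
  have vV : v \in V (~~ odd i).
    by apply: VM; [apply: VM => //; apply: AsV | apply/VV/AsV].
  (* [t1] carries edge [j.+1] of the axis to edge [i.+1] of the translated path. Its image is a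
     product of elements centralizing [psi a], so [t1] centralizes [a]. *)
  pose t1 := prefix x (j0 + i) * v * (prefix x j.+1)^-1.
  have psi_t1 : psi t1 = z0^-1 * z.
    rewrite /t1 /v !mulgA -hw -[h * _ * _]mulgA -prefixS.
    rewrite pq_morphM [psi (_ * u^-1)]pq_morphM psi_h ez !pq_morphV pq_morphM.
    by rewrite !mulgA !mulgK.
  have t1a : commute t1 a.
    apply: psi_commute; first apply: mem_axis_connectors vV => //.
      by rewrite mul2n -addnn leq_add // ltnW.
    rewrite psi_t1; apply/commute_sym/commuteM; last exact: commute_sym.
    exact/commuteV/commute_sym.
  have t1p : t1 * prefix x j = prefix x (j0 + i) * (v * (x j)^-1).
    by rewrite /t1 prefixS invMg !mulgA mulgVK.
  have stepA : (x (j0 + i))^-1 * (v * (x j)^-1) * x j \in A.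
    apply: (centralizer_axis_step xL t1a t1p); first by rewrite ji j0i.
    by rewrite j0i; apply: VM => //; apply: VV; rewrite -ji.
  exists ((x (j0 + i))^-1 * v * u).
    by apply: AM uA; move: stepA; rewrite mulgA mulgVK.
  by rewrite addnS !prefixS mulgA hw /v !mulgA mulgK mulgVK.
have [w wA hw] := follow L (leqnn L).
have hL : psi (h * prefix y L) = psi (a * h).
  rewrite psi_h -e !(pq_morphM psi (prefix x L)) gu0 [psi _ * (z0 * _)]mulgA.
  by rewrite -(z0a : _ * _ = _) -mulgA mulKg.
(* After one period the path ends at [a * prefix x j0 * w], while [a * h] is [a * prefix x j0 * u0];
   their images agree and [psi] is injective on [A]. *)
have wu0 : w = u0.
  apply: (psi_inj true); rewrite ?AsV //; move: hL.
  by rewrite hw (prefix_period xL) -mulgA !pq_morphM => /mulgI /mulgI.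
exists h; rewrite conjgE; apply: (mulgI h); rewrite mulVKg /a' hw wu0.
by rewrite (prefix_period xL) mulgA.
Qed.

(** * Combining the elliptic and hyperbolic cases *)

Lemma factor_not_cyc_reduced b x y : x \in V b -> cyc_reduced y ->
  ~ conj_in_pquotients p x y.
Proof.
move=> xV [s [sr se sN0 ->]] xy; have [m m0 xm] := factor_torsion GVA xV.
have [psi psiP] := pquotient_faithful_on (amalgam_residual GVA) [:: word s ^+ m].
have /eqP := cyc_reduced_word_expg sr se sN0 m0; apply.
apply: psiP; first by rewrite inE.
have [g e] := xy psi; apply: (mulgI (psi g)); rewrite mulg1 -pq_morphM.
have conjX k : psi (x ^+ k * g) = psi (g * word s ^+ k).
  elim: k => [|k IHk]; first by rewrite mul1g mulg1.
  rewrite !expgS -mulgA (pq_morphM psi x) IHk -pq_morphM !mulgA.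
  by rewrite (pq_morphM psi (x * g)) e -pq_morphM.
by rewrite -conjX xm mul1g.
Qed.

Lemma conj_of_pquotients (x y : G) : conj_in_pquotients p x y -> exists h, x ^ h = y.
Proof.
have [d yd] := conj_factor_or_cyc_reduced y.
have [c xc] := conj_factor_or_cyc_reduced x.
move=> /(@conj_in_pquotientsJ p G x y c d) xy.
suff [h xyh] : exists h, (x ^ c) ^ h = y ^ d.
  by exists (c * h * d^-1); rewrite !conjgM xyh conjgK.
have yx := conj_in_pquotients_sym xy.
case: xc yd => [[b1 xV] | xr] [[b2 yV] | yr].
- exact: factor_conj_of_pquotients xV yV xy.
- by case: (factor_not_cyc_reduced xV yr xy).
- by case: (factor_not_cyc_reduced yV xr yx).
have [u [L [uL eu]]] := cyc_reduced_axis xr.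
have [v [M [vM ev]]] := cyc_reduced_axis yr.
rewrite eu ev in xy yx *; case: (leqP M L) => [ML | /ltnW LM].
  exact: axis_conj_of_pquotients uL vM ML xy.
have [h e] := axis_conj_of_pquotients vM uL LM yx.
by exists h^-1; rewrite -e conjgK.
Qed.

End Amalgam.

(** * Transfer to abstract amalgams *)

Section AbsGroupTheory.

Variable G : AbsGroup.

HB.instance Definition _ := gen_eqMixin (carrier G).
HB.instance Definition _ := gen_choiceMixin (carrier G).

Fact ginvr (x : G) : gmul x (ginv x) = gone G.
Proof.
rewrite -[LHS]gmul1 -{1}(gmulV (ginv x)) -gmulA (gmulA (ginv x) x) gmulV gmul1.
exact: gmulV.
Qed.

Fact gmulr1 (x : G) : gmul x (gone G) = x.
Proof. by rewrite -(gmulV x) gmulA ginvr gmul1. Qed.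

HB.instance Definition _ := isGroup.Build (carrier G)
  (@gmulA G) (@gmul1 G) gmulr1 (@gmulV G) ginvr.

End AbsGroupTheory.

Definition abs_group (gT : finGroupType) : AbsGroup :=
  @MkGroup gT (fun x y => x * y) (fun x => x^-1) 1 (@mulgA gT) (@mul1g gT) (@mulVg gT).

Lemma onto_image_quotient p (G : AbsGroup) (psi : pquotient p (carrier G)) :
  exists (gT : finGroupType) (f : G -> gT) (v : gT -> pq_group psi),
    [/\ onto_p_group p f, {morph v : x y / x * y}, injective v &
        forall g, v (f g) = psi g].
Proof.
pose I := [set y | `[< exists g, y = psi g >]].
have psiI g : psi g \in I by rewrite inE; apply/asboolP; exists g.
have gI : group_set I.
  apply/group_setP; split=> [|x y]; first by rewrite -(pq_morph1 psi).
  by rewrite !inE => /asboolP[g ->] /asboolP[h ->]; apply/asboolP; exists (g * h);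
    rewrite pq_morphM.
exists (subg_of (Group gI)), (fun g => subg (Group gI) (psi g)), (@sgval _ (Group gI)).
split; [split | by [] | exact: subg_inj | by move=> g; rewrite subgK].
- by move=> x y; rewrite -subgM ?psiI // -pq_morphM.
- move=> y; have := subgP y; rewrite inE => /asboolP[g yg].
  by exists g; rewrite -yg sgvalK.
have := card_isog (isog_subg (Group gI)); rewrite /pgroup => <-.
exact: pgroupS (subsetT _) (pq_pgroup psi).
Qed.

Section ImageOfGroup.

Variables (gT : finGroupType) (S : {group gT}) (G : AbsGroup) (f : gT -> G).
Hypothesis fM : hom_on S f.

Lemma hom_on1 : f 1 = (1 : carrier G).
Proof. by apply: (mulgI (f 1)); rewrite mulg1 -[LHS]fM ?mulg1. Qed.

Lemma hom_onX x n : x \in S -> f (x ^+ n) = (f x : carrier G) ^+ n.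
Proof.
move=> xS; elim: n => [|n IHn]; first exact: hom_on1.
by rewrite !expgS -IHn [LHS]fM // groupX.
Qed.

Lemma image_subgroup_seq : subgroup_seq [seq f x | x <- enum S].
Proof.
split=> [|_ _ /mapP[x xS ->] /mapP[y yS ->]|_ /mapP[x xS ->]].
- by rewrite -hom_on1 map_f // mem_enum.
- rewrite mem_enum in xS; rewrite mem_enum in yS.
  by rewrite -[_ * _]fM // map_f // mem_enum groupM.
rewrite mem_enum in xS; apply/mapP; exists x^-1; first by rewrite mem_enum groupV.
by apply: (mulgI (f x)); rewrite mulgV -[RHS]fM ?groupV // mulgV hom_on1.
Qed.

Lemma image_torsion x : x \in [seq f x | x <- enum S] ->
  exists2 m, 0 < m & (x : carrier G) ^+ m = 1.
Proof.
case/mapP=> y; rewrite mem_enum => yS ->; exists #[y] => //.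
by rewrite -hom_onX // expg_order hom_on1.
Qed.

End ImageOfGroup.

(** * Induction over an amalgam *)

Section Submonoid.

Variables (G : AbsGroup) (Q : G -> Prop).
Hypothesis Q1 : Q (gone G).
Hypothesis QM : forall x y, Q x -> Q y -> Q (gmul x y).

Let Q' x := Q x /\ Q (ginv x).

Let sub_inj (u v : {x | Q' x}) : sval u = sval v -> u = v.
Proof.
by case: u v => x px [y py] /= xy; subst y; congr exist; apply: Prop_irrelevance.
Qed.

Let subM (u v : {x | Q' x}) : Q' (gmul (sval u) (sval v)).
Proof.
case: u v => x [Qx Qx'] [y [Qy Qy']]; split=> /=; first exact: QM.
by rewrite [ginv _](invgM x y); apply: QM.
Qed.

Let subV (u : {x | Q' x}) : Q' (ginv (sval u)).
Proof. by case: u => x [Qx Qx']; split; rewrite //= [ginv _](invgK x). Qed.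

Let sub1 : Q' (gone G).
Proof. by split; rewrite // (@invg1 (carrier G) : ginv (gone G) = gone G). Qed.

(* The largest subgroup contained in the submonoid [Q]. *)
Definition core_group : AbsGroup.
Proof.
refine (@MkGroup {x | Q' x} (fun u v => exist _ _ (subM u v))
  (fun u => exist _ _ (subV u)) (exist _ _ sub1) _ _ _).
- by move=> u v w; apply: sub_inj; apply: gmulA.
- by move=> u; apply: sub_inj; apply: gmul1.
- by move=> u; apply: sub_inj; apply: gmulV.
Defined.

Definition core_val (u : core_group) : G := sval u.

Lemma core_val_prop u : Q (core_val u).
Proof. by case: u => x []. Qed.

Lemma core_val_hom : is_hom core_val.
Proof. by []. Qed.

Lemma core_val_inj : injective core_val.
Proof. exact: sub_inj. Qed.

Lemma core_hom_on (gT : finGroupType) (S : {group gT}) (f : gT -> G) :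
  hom_on S f -> (forall x, x \in S -> Q (f x)) ->
  exists2 k : gT -> core_group, hom_on S k & forall x, x \in S -> core_val (k x) = f x.
Proof.
move=> fM fQ.
have fQ' x : x \in S -> Q' (f x).
  move=> xS; split; first exact: fQ.
  suff -> : ginv (f x) = f x^-1 by apply: fQ; rewrite groupV.
  by apply: (mulgI (f x)); rewrite [LHS]mulgV -[RHS]fM ?groupV // mulgV (hom_on1 fM).
pose k x : core_group :=
  if pselect (x \in S) is left xS then exist _ (f x) (fQ' x xS) else gone core_group.
have kE x : x \in S -> core_val (k x) = f x by rewrite /k; case: pselect.
exists k => // x y xS yS; apply: core_val_inj.
by rewrite core_val_hom !kE ?groupM // fM.
Qed.

End Submonoid.

(** Both factors map into the core group of [Q], hence so does [G]; composed with the inclusion this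
    map is the identity, by uniqueness. *)
Lemma amalgam_induction (hT kT : finGroupType) (H A : {group hT}) (K : {group kT})
    (phi : hT -> kT) (G : AbsGroup) (iH : hT -> G) (iK : kT -> G) (Q : G -> Prop) :
  is_amalgam H A K phi iH iK -> A \subset H -> (forall a, a \in A -> phi a \in K) ->
  (forall x, x \in H -> Q (iH x)) -> (forall y, y \in K -> Q (iK y)) ->
  (forall x y, Q x -> Q y -> Q (gmul x y)) -> forall z, Q z.
Proof.
move=> [hH hK hA univ] /subsetP AH phiK QH QK QM z.
have Q1 : Q (gone G) by rewrite -[gone G](hom_on1 hH); apply: QH.
have [f fM fE] := core_hom_on Q1 QM hH QH.
have [k kM kE] := core_hom_on Q1 QM hK QK.
have fk a : a \in A -> f a = k (phi a).
  by move=> aA; apply: core_val_inj; rewrite fE ?AH // kE ?phiK // hA.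
have [[h [hM hf hk]] _] := univ _ f k fM kM fk.
have [_ uniq] := univ G iH iK hH hK hA.
have <- : core_val (h z) = z; last exact: core_val_prop.
apply: (uniq (fun x => core_val (h x)) id) => //.
- by move=> x y; rewrite hM core_val_hom.
- by move=> x xH; rewrite hf ?fE.
by move=> y yK; rewrite hk ?kE.
Qed.

Theorem theorem1 (p : nat) (hT kT : finGroupType)
  (H A : {group hT}) (K B : {group kT}) (phi : {morphism A >-> kT})
  (G : AbsGroup) (iH : hT -> G) (iK : kT -> G) :
  prime p -> (p.-group H)%g -> (p.-group K)%g ->
  A \subset H -> B \subset K -> isom A B phi ->
  @is_amalgam hT kT H A K phi G iH iK ->
  (conj_p_separable p G <-> residually_p p G).
Proof.
move=> p_pr _ _ AH BK isoAB amG; have [hH hK hA univ] := amG.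
have phiK a : a \in A -> phi a \in K.
  by move=> aA; rewrite (subsetP BK) // -(isom_im isoAB) mem_morphim.
have AinH a : a \in A -> a \in H by apply: (subsetP AH).
split=> [sep g g1 | res a b ab].
  (* Only 1 is conjugate to 1, so separating [g] from 1 up to conjugacy makes the image of [g]
     nontrivial. *)
  have [|gT [psi [onto nconj]]] := sep g (gone G).
    case=> c /(congr1 (fun u => gmul c (gmul u (ginv c)))) e; apply: g1.
    move: e; rewrite [LHS](_ : _ = (c : carrier G) * (c^-1 * (g * c) * c^-1)) //.
    by rewrite mulgA mulKVg mulgK [RHS](_ : _ = c * (1 * c^-1)) // mul1g mulgV.
  exists gT, psi; split=> // psi1; apply: nconj; exists 1.
  have [psiM _ _] := onto; apply: (mulgI (psi g)).
  by rewrite conjg1 -[RHS]psiM (mulg1 g : gmul g (gone G) = g) psi1 mulg1.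
pose V b : seq (carrier G) :=
  if b then [seq iK y | y <- enum K] else [seq iH x | x <- enum H].
pose A' : seq (carrier G) := [seq iH a | a <- enum A].
have hAH : hom_on A iH by move=> x y xA yA; apply: hH; apply: AinH.
have GVA : residually_p_amalgam p V A'.
  split=> //.
  - by case; apply: image_subgroup_seq.
  - exact: image_subgroup_seq.
  - move=> [] _ /mapP[u + ->]; rewrite mem_enum => uA.
      by rewrite /V hA // map_f // mem_enum phiK.
    by rewrite /V map_f // mem_enum AinH.
  - by case=> x; apply: image_torsion.
  - move=> Q QV QM; apply: (amalgam_induction amG) => //.
      by move=> x xH; apply: (QV false); rewrite map_f // mem_enum.
    by move=> y yK; apply: (QV true); rewrite map_f // mem_enum.
  - move=> W f fM fA.
    have [|||[h [hM hf hk]] _] := univ (abs_group W) (f false \o iH) (f true \o iK).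
    + move=> x y xH yH; rewrite /= hH //.
      by apply: (fM false); rewrite map_f // mem_enum.
    + move=> x y xK yK; rewrite /= hK //.
      by apply: (fM true); rewrite map_f // mem_enum.
    + by move=> u uA; rewrite /= -hA // fA // map_f // mem_enum.
    exists h; split=> // -[] _ /mapP[x + ->]; rewrite mem_enum; [exact: hk | exact: hf].
  move=> g /eqP /res[gT [psi [[psiM _ pgT] psi1]]].
  by exists (PQuotient (psiM : {morph psi : x y / (x : carrier G) * y >-> x * y}) pgT); apply/eqP.
apply: contrapT => nsep; apply: ab.
suff /(conj_of_pquotients GVA)[c <-] : @conj_in_pquotients p (carrier G) a b by exists c.
move=> psi; have [gT [f [v [onto vM v_inj vf]]]] := onto_image_quotient psi.
have [[x xab]|nconj] := pselect (exists x : gT, f a ^ x = f b); last first.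
  by case: nsep; exists gT, f.
(* Surjectivity onto the image lifts the conjugator [x] to [G]. *)
have [fM fsurj _] := onto; have [g gx] := fsurj x.
exists g; rewrite -!vf; congr v.
by rewrite [f (a * g)]fM [f (g * b)]fM gx -xab conjgE mulKVg.
Qed.
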